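(* For any $\zeta>0$, for the random graph process $\{G^0_t:t\ge1\}$ with parameter $\zeta$, there exist positive constants $C_1^0$ and $C_2^0$ such that $$C_1^0\left(\frac{\zeta}{1+\zeta}\right)^k\le\liminf_{t\to\infty}\frac{\overline{D}_k(t)}{t}\le\limsup_{t\to\infty}\frac{\overline{D}_k(t)}{t}\le C_2^0\left(\frac{\zeta}{1+\zeta}\right)^k$$ for all $k\ge0$.
   Context: Here $u\wedge v=\min(u,v)$. For a constant $\zeta>0$, the (classical) random graph process $\{G^0_t=(V_t,E_t):t\ge1\}$ is defined as follows. Time-Step 1: $G_1^0$ consists of two vertices $x_0,x_1$ and the edge $\langle x_0,x_1\rangle$. Time-Step $t\ge2$: a new vertex $x_t$ is added to $G^0_{t-1}$, and then random edges incident with $x_t$ are added: for each $0\le i\le t-1$, the edge $\langle x_i,x_t\rangle$ is added independently with probability $(\zeta\wedge t)/t$. $D_k(t)$ denotes the number of vertices of degree $k$ in $G^0_t$ and $\overline{D}_k(t)=\mathbb{E}(D_k(t))$. *)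

(* Defs.v *)
From mathcomp Require Import all_boot all_order all_algebra.
From mathcomp Require Import all_classical all_reals all_analysis.

Set Implicit Arguments.
Unset Strict Implicit.
Unset Printing Implicit Defensive.

Import Order.TTheory GRing.Theory Num.Theory.
Import numFieldNormedType.Exports.

Local Open Scope classical_set_scope.
Local Open Scope ring_scope.

(* Only the events [A i] with [i] in [I] are constrained. *)
Definition mutually_independent (d : measure_display) (T : measurableType d)
    (R : realType) (P : probability T R) (K : choiceType) (I : set K)
    (A : K -> set T) : Prop :=
  (forall i, I i -> measurable (A i)) /\
  (forall J : seq K, uniq J -> [set` J] `<=` I ->
    P (\bigcap_(i in [set` J]) A i) = (\prod_(i <- J) P (A i))%E).

(* The vertex [x_i] is the ordinal [i]: the graph at time [t] has vertex set
   ['I_t.+1] and is given by its adjacency relation. *)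
Definition graph_process (T : Type) : Type := forall t : nat, T -> rel 'I_t.+1.

(* [new_edge G (Tagged _ i)], for [i : 'I_t], is the event that <x_i, x_t> is
   an edge of the graph at time [t]. *)
Definition new_edge (T : Type) (G : graph_process T)
    (p : {t : nat & 'I_t}) : set T :=
  [set w | G (tag p) w (widen_ord (leqnSn (tag p)) (tagged p)) ord_max].

(* Times start at 1, so [G 0] is left unconstrained. *)
Record random_graph_process (d : measure_display) (T : measurableType d)
    (R : realType) (P : probability T R) (zeta : R) (G : graph_process T) :
    Prop := RandomGraphProcess {
  rgp_sym : forall t w, (1 <= t)%N -> symmetric (G t w);
  rgp_irr : forall t w, (1 <= t)%N -> irreflexive (G t w);
  rgp_init : forall w, G 1%N w ord0 ord_max;
  rgp_step : forall t w (x y : 'I_t.+1), (1 <= t)%N ->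
    G t.+1 w (widen_ord (leqnSn t.+1) x) (widen_ord (leqnSn t.+1) y)
      = G t w x y;
  rgp_indep : mutually_independent P
    [set p : {t : nat & 'I_t} | (2 <= tag p)%N] (new_edge G);
  rgp_prob : forall t (i : 'I_t), (2 <= t)%N ->
    P (new_edge G (Tagged (fun s => 'I_s) i))
      = (Num.min zeta t%:R / t%:R)%:E
}.

Definition degree (V : finType) (e : rel V) (x : V) : nat := #|[set y | e x y]%SET|.

Definition degree_count (T : Type) (R : realType) (G : graph_process T)
    (k t : nat) (w : T) : R :=
  #|[set x : 'I_t.+1 | degree (G t w) x == k]%SET|%:R.

Definition mean_degree_count (d : measure_display) (T : measurableType d)
    (R : realType) (P : probability T R) (G : graph_process T)
    (k t : nat) : \bar R :=
  'E_P[degree_count R G k t]%E.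

(* Main.v *)
Require Import Defs.
From mathcomp Require Import all_boot all_order all_algebra.
From mathcomp Require Import all_classical all_reals all_analysis.
From mathcomp Require Import measurable_realfun ring lra.

Import Order.TTheory GRing.Theory Num.Theory.
Import numFieldNormedType.Exports.

Local Open Scope ring_scope.

(** Let m_k(t) be the mean number of vertices of degree k at time t.  Each old
vertex x is joined to the vertex arriving at time t+1 with probability
zeta/(t+1) (once t+1 >= zeta), independently of the edges present at time t,
hence of the degree of x.  This gives

  m_k(t+1) = (1 - zeta/(t+1)) m_k(t) + zeta/(t+1) m_(k-1)(t) + b_k(t+1)

([mean_count_rec]), where b_k(t), the probability that the newcomer has degree
k, is the binomial mass of parameters t and zeta/t ([pmass_new_vertex]).

If m_k grew like u_k t and b_k(t) were close to beta_k, the recursion would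
force (1 + zeta) u_k = zeta u_(k-1) + beta_k.  For any exact solution u of this
equation, u_k (t+1) solves the recursion with b_k replaced by beta_k, and a
constant B only makes it easier to be a supersolution.  So
m_k(t) <= u_k (t+1) + B as soon as b_k <= beta_k ([recursion_le]), and
symmetrically from below ([recursion_ge]); no convergence of m_k(t)/t has to be
established.  With rho = zeta/(1+zeta), two choices of beta suffice.

- Above, b_k(t) <= zeta^k/k! and
  u_k = rho^k/(1+zeta) * sum_(j <= k) (1+zeta)^j/j!
      <= exp(1+zeta)/(1+zeta) * rho^k.
- Below, only newcomers of degree 0 are kept: b_0(t) = (1 - zeta/t)^t is at
  least exp(-2 zeta) when t >= 2 zeta, and beta_k = 0 for k > 0 gives
  u_k = exp(-2 zeta)/(1+zeta) * rho^k.

The probabilistic input is the independence of the degree of an old vertex from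
the later edges.  It is carried by the predicate [decoupled], which is preserved
when one more independent event is counted ([decoupled_add_event]), so that it
follows for all degrees by induction on time ([decoupled_degree]). *)

(** * Upper and lower limits of ratios *)

(** For every e > 0, the bound c + b/n is at most c + e once n > b/e, so the
supremum of a tail of the sequence is at most c + e. *)
Lemma limn_esup_ratio_le {R : realType} (u : nat -> \bar R) (c b : R) (N : nat) :
  (forall n, (N <= n)%N -> (u n <= (c * n%:R + b)%:E)%E) ->
  (limn_esup (fun n => u n / (n%:R)%:E) <= c%:E)%E.
Proof.
move=> ub; apply/lee_addgt0Pr => e e0.
pose M := maxn N.+1 (Num.truncn (b / e)).+1.
apply: (@le_trans _ _
  (ereal_sup [set (u n / (n%:R)%:E)%E | n in [set n | (M <= n)%N]]%classic)).
  by apply: ereal_inf_lbound => /=; exists [set n | (M <= n)%N]%classic => //; exists M.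
apply: ge_ereal_sup => _ [n /= Mn <-].
have [Nn bn] : (N < n)%N /\ (Num.truncn (b / e) < n)%N.
  by move: Mn; rewrite geq_max => /andP[].
have n0 : (0 < n%:R :> R) by rewrite ltr0n (leq_ltn_trans _ Nn).
rewrite inver gt_eqF// lee_pdivrMr//.
apply: (le_trans (ub n (ltnW Nn))).
rewrite -EFinD -EFinM lee_fin mulrDl lerD2l.
have : b / e < n%:R by apply: (lt_le_trans (truncnS_gt _)); rewrite ler_nat.
by rewrite ltr_pdivrMr// mulrC => /ltW.
Qed.

Lemma limn_einf_ratio_ge {R : realType} (u : nat -> \bar R) (c b : R) (N : nat) :
  (forall n, (N <= n)%N -> ((c * n%:R + b)%:E <= u n)%E) ->
  (c%:E <= limn_einf (fun n => u n / (n%:R)%:E))%E.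
Proof.
move=> lb; rewrite /limn_einf leeNr.
under [X in limn_esup X]eq_fun do rewrite -mulNe.
apply: (@limn_esup_ratio_le _ (fun n => - u n)%E _ (- b) N) => n /lb.
by rewrite mulNr -opprD EFinN leeN2.
Qed.

(** * Comparison principle for the recursion *)

Definition delay {R : nmodType} (f : nat -> R) (k : nat) : R :=
  if k is k'.+1 then f k' else 0.

(** The affine functions u_k (t+1) + B are supersolutions: inserted in the
recursion they gain u_k at each step, which is exactly the increment of
u_k (t+1), by the equation satisfied by u.  The constant B is transported
unchanged, except at k = 0, where the step loses zeta/(t+1) * B >= 0.  The
hypothesis zeta <= T0 makes 1 - zeta/(t+1) nonnegative, so that the recursion
is monotone in m. *)
Lemma recursion_le {R : realType} (zeta B : R) (T0 : nat)
    (m b : nat -> nat -> R) (u beta : nat -> R) :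
  0 < zeta -> zeta <= T0%:R -> 0 <= B ->
  (forall k t, (T0 <= t)%N -> m k t.+1 = (1 - zeta / t.+1%:R) * m k t
     + zeta / t.+1%:R * delay (m ^~ t) k + b k t.+1) ->
  (forall k t, (T0 < t)%N -> b k t <= beta k) ->
  (forall k, (1 + zeta) * u k = zeta * delay u k + beta k) ->
  (forall k, m k T0 <= u k * T0.+1%:R + B) ->
  forall t k, (T0 <= t)%N -> m k t <= u k * t.+1%:R + B.
Proof.
move=> z0 zT B0 rec bb ru m0 t k T0t.
rewrite -(subnKC T0t); move: (t - T0)%N => n {t T0t}.
elim: n k => [|n IH] k; first by rewrite addn0.
rewrite addnS; set t := (T0 + n)%N in IH *.
have T0t : (T0 <= t)%N by exact: leq_addr.
rewrite rec//; set q := zeta / _.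
have t0 : 0 < t.+1%:R :> R by rewrite ltr0n.
have qt : q * t.+1%:R = zeta by rewrite divfK// gt_eqF.
have q0 : 0 <= q by rewrite divr_ge0 ?ltW.
have q1 : 0 <= 1 - q.
  by rewrite subr_ge0 ler_pdivrMr// mul1r (le_trans zT)// ler_nat (leq_trans T0t).
have dB : delay (m ^~ t) k <= delay u k * t.+1%:R + B.
  by case: k => [|k] /=; rewrite ?mul0r ?add0r ?IH.
have h1 := ler_wpM2l q1 (IH k).
have h2 := ler_wpM2l q0 dB.
have h3 := bb k t.+1 T0t.
have h4 := ru k.
rewrite [t.+2%:R]mulrSr.
have e1 : q * (delay u k * t.+1%:R + B) = zeta * delay u k + q * B by rewrite -qt; ring.
have e2 : (1 - q) * (u k * t.+1%:R + B) = u k * t.+1%:R + B - zeta * u k - q * B.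
  by rewrite -qt; ring.
lra.
Qed.

(** The recursion is linear, so this is the upper bound applied to -m, -b, -u
and -beta. *)
Lemma recursion_ge {R : realType} (zeta B : R) (T0 : nat)
    (m b : nat -> nat -> R) (u beta : nat -> R) :
  0 < zeta -> zeta <= T0%:R -> 0 <= B ->
  (forall k t, (T0 <= t)%N -> m k t.+1 = (1 - zeta / t.+1%:R) * m k t
     + zeta / t.+1%:R * delay (m ^~ t) k + b k t.+1) ->
  (forall k t, (T0 < t)%N -> beta k <= b k t) ->
  (forall k, (1 + zeta) * u k = zeta * delay u k + beta k) ->
  (forall k, u k * T0.+1%:R - B <= m k T0) ->
  forall t k, (T0 <= t)%N -> u k * t.+1%:R - B <= m k t.
Proof.
move=> z0 zT B0 rec bb ru m0 t k T0t; rewrite -lerN2 opprB addrC -mulNr.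
apply: (@recursion_le _ zeta B T0 (fun k t => - m k t) (fun k t => - b k t)
  (fun k => - u k) (fun k => - beta k)) => //.
- by move=> {T0t}k {}t T0t; rewrite rec//; case: k => [|k] /=; ring.
- by move=> {}k {T0t}t T0t; rewrite lerN2 bb.
- by move=> {}k; rewrite mulrN ru; case: k => [|k] /=; ring.
- by move=> {}k; rewrite -lerN2 opprK opprD mulNr opprK m0.
Qed.

(** * Binomial masses and the exponential *)

Lemma sum_exp_coeff_le {R : realType} (x : R) (k : nat) : 0 <= x ->
  series (exp_coeff x) k <= expR x.
Proof.
move=> x0; apply: nondecreasing_cvgn_le; last exact: is_cvg_series_exp_coeff.
apply/nondecreasing_seqP => n; rewrite seriesSr lerDl.
exact: exp_coeff_ge0.
Qed.

(** Dropping the factor (1 - zeta/n)^(n-k) <= 1, this is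
C(n,k) k! = n(n-1)...(n-k+1) <= n^k. *)
Lemma binomial_le_poisson {R : realType} (zeta : R) (n k : nat) :
  0 <= zeta <= n%:R ->
  'C(n, k)%:R * (zeta / n%:R) ^+ k * (1 - zeta / n%:R) ^+ (n - k)
    <= exp_coeff zeta k.
Proof.
move=> /andP[z0 zn].
have q0 : 0 <= zeta / n%:R by rewrite divr_ge0.
have q1 : zeta / n%:R <= 1.
  have [->|n0] := posnP n; first by rewrite invr0 mulr0.
  by rewrite ler_pdivrMr ?ltr0n// mul1r.
apply: (@le_trans _ _ ('C(n, k)%:R * (zeta / n%:R) ^+ k)).
  rewrite ler_piMr ?mulr_ge0 ?exprn_ge0// exprn_ile1 ?subr_ge0//.
  by rewrite gerBl.
rewrite exp_coeffE expr_div_n.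
have k0 : 0 < k`!%:R :> R by rewrite ltr0n fact_gt0.
rewrite -(ler_pM2l k0) !mulrA mulfV ?gt_eqF// mul1r.
rewrite [_ * 'C(n, k)%:R]mulrC -natrM bin_ffact.
have ffle : (n ^_ k <= n ^ k)%N.
  elim: k {k0} => [|k IH]; first by rewrite ffactn0.
  by rewrite ffactnSr expnSr leq_mul ?leq_subr.
(* For n = 0 the hypothesis forces zeta = 0; division by 0 yields 0. *)
have [n0|n0] := posnP n; last first.
  rewrite mulrAC ler_piMl ?exprn_ge0//.
  by rewrite ler_pdivrMr ?mul1r -?natrX ?ler_nat// ltr0n expn_gt0 n0.
move: zn; rewrite n0 => zn; have {z0 zn q0 q1}-> : zeta = 0 by apply/le_anti; rewrite zn.
case: k {k0 ffle} => [|k]; first by rewrite ffactn0 !expr0 invr1 !mulr1.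
by rewrite !expr0n/= mulr0 mul0r.
Qed.

(** With q = zeta/n <= 1/2 it suffices that exp(-2q) <= 1 - q, which follows from
1/(1-q) <= 1 + 2q <= exp(2q). *)
Lemma expR_le_binomial0 {R : realType} (zeta : R) (n : nat) :
  0 < zeta -> zeta *+ 2 <= n%:R -> expR (- (zeta *+ 2)) <= (1 - zeta / n%:R) ^+ n.
Proof.
move=> z0 zn.
have n0 : 0 < n%:R :> R by apply: lt_le_trans zn; rewrite pmulrn_rgt0.
set q := zeta / n%:R.
have qn : q * n%:R = zeta by rewrite divfK ?gt_eqF.
have q0 : 0 < q by rewrite divr_gt0.
have q1 : q *+ 2 <= 1 by rewrite /q -mulrnAl ler_pdivrMr// mul1r.
have -> : - (zeta *+ 2) = n%:R * (- (q *+ 2)) by rewrite -qn; ring.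
rewrite expRM_natl lerXn2r ?nnegrE ?expR_ge0 //; first by lra.
rewrite expRN -[leRHS]invrK lef_pV2 ?posrE ?expR_gt0 ?invr_gt0; try lra.
apply: le_trans (expR_ge1Dx _); rewrite -[leLHS]mul1r ler_pdivrMr; last by lra.
nra.
Qed.

(** * Counting independent events *)

Definition pmass {d : measure_display} {T : measurableType d} {R : realType}
    (P : probability T R) (N : T -> nat) (k : nat) : R :=
  fine (P [set w | N w = k]%classic).

(** Independence of N from the family of the A_i, i in L, is tested on finite
intersections of the A_i alone, as in the definition of mutual independence, so
that the two notions combine directly. *)
Definition decoupled {d : measure_display} {T : measurableType d} {R : realType}
    (P : probability T R) {K : choiceType} (A : K -> set T) (N : T -> nat)
    (L : set K) : Prop :=
  (forall k, measurable [set w | N w = k]%classic) /\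
  (forall k (J : seq K), uniq J -> ([set` J] `<=` L)%classic ->
    fine (P ([set w | N w = k] `&` \bigcap_(i in [set` J]) A i)%classic)
      = pmass P N k * \prod_(i <- J) fine (P (A i))).

Section Decoupled.
#[local] Set Implicit Arguments.
#[local] Unset Strict Implicit.
Context {d : measure_display} {T : measurableType d} {R : realType}.
Context (P : probability T R) {K : choiceType} (I : set K) (A : K -> set T).
Hypothesis indep : mutually_independent P I A.
Local Open Scope classical_set_scope.
Implicit Types (N : T -> nat) (L : set K) (J : seq K) (k : nat) (a : K).

Let set_seq_cons a J : [set` a :: J] = a |` [set` J].
Proof.
apply/seteqP; split=> i; rewrite /= inE; first by case/orP => [/eqP|]; [left|right].
by case=> [->|->]; rewrite ?eqxx ?orbT.
Qed.

Let measurable_event a : I a -> measurable (A a).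
Proof. exact: indep.1. Qed.

Let fineP_measurable (X : set T) : measurable X -> P X = (fine (P X))%:E.
Proof. by move=> mX; rewrite fineK// fin_num_measure. Qed.

Let measurable_events J : [set` J] `<=` I -> measurable (\bigcap_(i in [set` J]) A i).
Proof.
elim: J => [|a J IH] JI; first by rewrite set_nil bigcap_set0.
rewrite set_seq_cons bigcap_setU1; apply: measurableI.
  by apply: measurable_event; apply: JI; rewrite /= inE eqxx.
by apply: IH => i Ji; apply: JI; rewrite /= inE Ji orbT.
Qed.

Let bigcap_cons a J :
  \bigcap_(i in [set` a :: J]) A i = A a `&` \bigcap_(i in [set` J]) A i.
Proof.
by rewrite set_seq_cons bigcap_setU1.
Qed.

Lemma decoupled_cst (n : nat) : decoupled P A (fun=> n) I.
Proof.
have cstE k : [set w : T | n = k] = if n == k then setT else set0.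
  by have [->|/eqP nk] := eqVneq n k; apply/seteqP; split.
split=> [k|k J uJ JI]; rewrite /pmass cstE; first by case: ifP.
case: ifP => _; last by rewrite set0I measure0/= mul0r.
rewrite setTI probability_setT/= mul1r (indep.2 J uJ JI).
rewrite (eq_big_seq (fun i => (fine (P (A i)))%:E)) ?prodEFin//.
by move=> i Ji; rewrite -fineP_measurable//; apply/measurable_event/JI.
Qed.

Lemma decoupledW N L L' : L' `<=` L -> decoupled P A N L -> decoupled P A N L'.
Proof.
by move=> LL' [mN dN]; split=> // k J uJ /subset_trans-/(_ _ LL'); exact: dN.
Qed.

(* Conditioning on the counted event: N goes up by one on it, and is unchanged off
it. *)
Let add_event_eq N a k :
  [set w | ((w \in A a) + N w)%N = k]
    = ([set w | (N w).+1 = k] `&` A a) `|` ([set w | N w = k] `\` A a).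
Proof.
apply/seteqP; split=> w /=.
  have [/set_mem Aa|/negP nAa] := boolP (w \in A a); first by left.
  by right; split=> // /mem_set.
by case=> -[<-] Aw; [rewrite mem_set | rewrite memNset].
Qed.

Let measurable_succ N k : (forall k', measurable [set w | N w = k']) ->
  measurable [set w | (N w).+1 = k].
Proof.
move=> mN; case: k => [|k].
  by rewrite [X in measurable X](_ : _ = set0)//; apply/seteqP; split.
rewrite [X in measurable X](_ : _ = [set w | N w = k])//.
by apply/seteqP; split=> w /= => [[]|->].
Qed.

(* The common source of the next two lemmas: the mass function of N plus the
indicator of A_a (take J empty), and its independence from the remaining events.
The part of the event on which A_a fails is obtained as a difference, so only
intersections of the A_i occur, namely those indexed by J and by a :: J. *)
Let add_event_prob N L a k J : L `<=` I -> decoupled P A N L -> L a ->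
  uniq J -> [set` J] `<=` L `\ a ->
  fine (P ([set w | ((w \in A a) + N w)%N = k] `&` \bigcap_(i in [set` J]) A i))
    = (fine (P (A a)) * delay (pmass P N) k + (1 - fine (P (A a))) * pmass P N k)
      * \prod_(i <- J) fine (P (A i)).
Proof.
move=> LI [mN dN] La uJ JL; set E := \bigcap_(i in _) A i.
have JL' : [set` J] `<=` L by move=> i /JL[].
have mE : measurable E by apply: measurable_events; exact: subset_trans JL' LI.
have mA := measurable_event (LI _ La).
have aJ : a \notin J by apply/negP => /JL[_]; exact.
have aJL : [set` a :: J] `<=` L.
  by move=> i /=; rewrite inE => /orP[/eqP->//|]; exact: JL'.
have uaJ : uniq (a :: J) by rewrite /= aJ.
have mS := measurable_succ k mN.
have m1 : measurable ([set w | (N w).+1 = k] `&` A a `&` E).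
  by apply: measurableI => //; exact: measurableI.
have m2 : measurable (([set w | N w = k] `\` A a) `&` E).
  by apply: measurableI => //; exact: measurableD.
rewrite add_event_eq setIUl measureU//; last first.
  by apply/seteqP; split=> w //= [[[_ Aw] _] [[_ /(_ Aw)]]].
rewrite fineD ?fin_num_measure//.
rewrite mulrDl; congr (_ + _).
  rewrite -setIA -bigcap_cons; case: (k) => [|k'] /=.
    rewrite (_ : [set w | _] = set0); last by apply/seteqP; split.
    by rewrite set0I measure0/= mulr0 mul0r.
  rewrite (_ : [set w | _] = [set w | N w = k']); last first.
    by apply/seteqP; split=> w /= => [[]|->].
  by rewrite dN// big_cons; ring.
rewrite setIDAC setIDA measureD//; [|exact: measurableI|]; last first.
  by rewrite ltey_eq fin_num_measure//; exact: measurableI.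
rewrite fineB; try by rewrite fin_num_measure//; repeat apply: measurableI => //.
rewrite -setIA [E `&` _]setIC -bigcap_cons !dN// big_cons; ring.
Qed.

Lemma pmass_add_event N L a k : L `<=` I -> decoupled P A N L -> L a ->
  pmass P (fun w => (w \in A a) + N w)%N k
    = fine (P (A a)) * delay (pmass P N) k + (1 - fine (P (A a))) * pmass P N k.
Proof.
move=> LI dN La; have := @add_event_prob N L a k [::] LI dN La isT.
by rewrite set_nil bigcap_set0 setIT big_nil mulr1; apply=> i.
Qed.

Lemma decoupled_add_event N L a : L `<=` I -> decoupled P A N L -> L a ->
  decoupled P A (fun w => (w \in A a) + N w)%N (L `\ a).
Proof.
move=> LI dN La; split=> [k|k J uJ JL].
  have mA := measurable_event (LI _ La); rewrite add_event_eq.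
  apply: measurableU; last by apply: measurableD => //; exact: dN.1.
  by apply: measurableI => //; apply: measurable_succ; exact: dN.1.
by rewrite (add_event_prob _ LI)// -(pmass_add_event k LI).
Qed.

Lemma decoupled_count (s : seq K) : uniq s -> [set` s] `<=` I ->
  decoupled P A (fun w => \sum_(i <- s) (w \in A i))%N (I `\` [set` s]).
Proof.
elim: s => [_ _|a s IH /= /andP[as_ us] sI].
  rewrite set_nil setD0; under eq_fun do rewrite big_nil.
  exact: decoupled_cst.
have sI' : [set` s] `<=` I by move=> i si; apply: sI; rewrite /= inE si orbT.
under eq_fun do rewrite big_cons.
have Da : (I `\` [set` s]) a.
  by split; [apply: sI; rewrite /= inE eqxx|exact/negP].
apply: decoupledW (decoupled_add_event _ (IH us sI') Da); last by move=> i [].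
move=> i [Ii /= si]; split; first by split=> // /= si'; apply: si; rewrite inE si' orbT.
by move=> /= ia; apply: si; rewrite ia inE eqxx.
Qed.

(** The binomial law, through Pascal's rule: counting one more event acts on the
mass function by [pmass_add_event]. *)
Lemma pmass_count (s : seq K) (p : R) (k : nat) : uniq s -> [set` s] `<=` I ->
  (forall i, i \in s -> fine (P (A i)) = p) ->
  pmass P (fun w => \sum_(i <- s) (w \in A i))%N k
    = 'C(size s, k)%:R * p ^+ k * (1 - p) ^+ (size s - k).
Proof.
elim: s k => [k _ _ _|a s IH k /= /andP[as_ us] sI ps].
  rewrite /pmass; under eq_fun do rewrite big_nil.
  case: k => [|k].
    rewrite (_ : [set _ | _] = setT); last by apply/seteqP; split.
    by rewrite probability_setT/= bin0 !expr0 !mulr1.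
  rewrite (_ : [set _ | _] = set0); last by apply/seteqP; split.
  by rewrite measure0/= bin0n !mul0r.
have sI' : [set` s] `<=` I by move=> i si; apply: sI; rewrite /= inE si orbT.
have ps' i : i \in s -> fine (P (A i)) = p by move=> si; rewrite ps// inE si orbT.
under [X in pmass P X]eq_fun do rewrite big_cons.
rewrite (pmass_add_event k _ (decoupled_count us sI')); last 2 first.
- by move=> i [].
- by split; [apply: sI; rewrite /= inE eqxx|exact/negP].
rewrite ps ?inE ?eqxx// IH//; case: k => [|k] /=.
  by rewrite !bin0 !expr0 !subn0 exprS; ring.
rewrite IH// binS natrD subSS exprS.
(* When k >= size s the exponent size s - k.+1 is truncated, but its binomial
   coefficient vanishes. *)
have [ks|sk] := ltnP k (size s); last first.
  by rewrite (@bin_small _ k.+1) ?ltnS//; ring.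
by rewrite -(subnSK ks) exprS; ring.
Qed.

End Decoupled.

(** * The degrees in the random graph process *)

Section DegreeProcess.
Context {R : realType} (zeta : R) {d : measure_display} {T : measurableType d}.
Context (P : probability T R) (G : graph_process T).
Hypothesis hG : random_graph_process P zeta G.
#[local] Set Implicit Arguments.
#[local] Unset Strict Implicit.
Local Open Scope classical_set_scope.

Let edge (t : nat) (i : 'I_t) : {t : nat & 'I_t} := Tagged (fun s => 'I_s) i.

(* The edge present at time 1 is deterministic, hence the bound 2. *)
Let free : set {t : nat & 'I_t} := [set p | (2 <= tag p)%N].

Let deg (t : nat) (x : 'I_t.+1) (w : T) : nat := degree (G t w) x.

(** A real-valued form of the mean degree count, by linearity of expectation; the
two agree from time 1 on, see [mean_degree_countE]. *)
Definition mean_count (k t : nat) : R := \sum_(x : 'I_t.+1) pmass P (deg x) k.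

Let degreeE (V : finType) (e : rel V) (x : V) : degree e x = (\sum_y e x y)%N.
Proof.
rewrite /degree -sum1_card big_mkcond; apply: eq_bigr => y _.
by rewrite inE; case: (e x y).
Qed.

Let mem_new_edge (t : nat) (i : 'I_t.+1) w :
  (w \in new_edge G (edge i)) = G t.+1 w (widen_ord (leqnSn t.+1) i) ord_max.
Proof. by apply/idP/idP => [/set_mem|] h; [|exact: mem_set]. Qed.

Let deg_init (x : 'I_2) : deg x = fun=> 1%N.
Proof.
apply/funext => w; rewrite /deg degreeE !big_ord_recr big_ord0 /=.
have -> : widen_ord (leqnSn 1) ord_max = ord0 :> 'I_2 by exact: val_inj.
have g01 := rgp_init hG w; have gs := rgp_sym hG w (leqnn 1).
have gi := rgp_irr hG w (leqnn 1).
case: x => -[|[|//]] p.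
  by rewrite (_ : Ordinal p = ord0) ?gi ?g01//; exact: val_inj.
by rewrite (_ : Ordinal p = ord_max) ?gi ?[G _ _ _ ord0]gs ?g01//; exact: val_inj.
Qed.

Let deg_old (t : nat) (x : 'I_t.+1) : (1 <= t)%N ->
  deg (widen_ord (leqnSn t.+1) x)
    = fun w => ((w \in new_edge G (edge x)) + deg x w)%N.
Proof.
move=> t1; apply/funext => w; rewrite /deg !degreeE big_ord_recr /= addnC.
rewrite mem_new_edge; congr addn; apply: eq_bigr => y _.
by rewrite (rgp_step hG).
Qed.

Let deg_new (t : nat) :
  deg (@ord_max t.+1)
    = fun w => (\sum_(p <- map (@edge t.+1) (enum 'I_t.+1)) (w \in new_edge G p))%N.
Proof.
apply/funext => w; rewrite /deg degreeE big_ord_recr /= (rgp_irr hG)// addn0.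
rewrite big_map big_enum; apply: eq_bigr => y _.
by rewrite mem_new_edge (rgp_sym hG).
Qed.

Let edge_inj (t : nat) : injective (@edge t).
Proof. by move=> i j /eqP; rewrite eq_Tagged => /eqP. Qed.

Let uniq_edges (t : nat) : uniq (map (@edge t) (enum 'I_t)).
Proof. by rewrite map_inj_uniq ?enum_uniq//; exact: edge_inj. Qed.

Let edges_free (t : nat) : (2 <= t)%N ->
  [set` map (@edge t) (enum 'I_t)] `<=` free.
Proof. by move=> t2 _ /= /mapP[i _ ->]. Qed.

Let edges_prob (t : nat) p : (2 <= t)%N -> p \in map (@edge t) (enum 'I_t) ->
  fine (P (new_edge G p)) = Num.min zeta t%:R / t%:R.
Proof. by move=> t2 /mapP[i _ ->]; rewrite (rgp_prob hG). Qed.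

(** At time 1 the degrees are constant.  Afterwards an old degree increases by the
indicator of one new edge event, and the degree of a newcomer counts its own
edge events; in both cases only events of time at most t are used up. *)
Lemma decoupled_degree (t : nat) (x : 'I_t.+1) : (1 <= t)%N ->
  decoupled P (new_edge G) (deg x) [set p | (t < tag p)%N].
Proof.
have indep := rgp_indep hG.
elim: t x => [//|[_ x _|t IH x _]].
  by rewrite deg_init; apply: decoupledW (decoupled_cst indep 1).
have [xt|tx] := ltnP x t.+2.
  have -> : x = widen_ord (leqnSn t.+2) (Ordinal xt) by exact: val_inj.
  rewrite deg_old//.
  apply: (@decoupledW _ _ _ _ _ _ _ ([set p | (t.+1 < tag p)%N] `\ edge (Ordinal xt))).
    by move=> p /= tp; split; [exact: ltnW|move=> pe; move: tp; rewrite pe /= ltnn].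
  apply: (decoupled_add_event indep); [|exact: IH|exact: ltnSn].
  by move=> p /=; apply: leq_trans; rewrite ltnS.
have -> : x = ord_max.
  by apply: val_inj; apply/eqP; rewrite eqn_leq /= tx -ltnS ltn_ord.
rewrite deg_new; apply: decoupledW (decoupled_count indep (uniq_edges _) _).
  move=> p /= tp; split; first by rewrite /= (leq_trans _ tp).
  by move=> /= /mapP[i _ pi]; move: tp; rewrite pi ltnn.
exact: edges_free.
Qed.

Lemma mean_degree_countE (k t : nat) : (1 <= t)%N ->
  mean_degree_count P G k t = (mean_count k t)%:E.
Proof.
move=> t1; rewrite /mean_degree_count unlock.
have mdeg (x : 'I_t.+1) : measurable [set w | deg x w = k].
  exact: (decoupled_degree x t1).1.
transitivity (\int[P]_w (\sum_(x <- enum 'I_t.+1) (\1_[set w | deg x w = k] w)%:E))%E.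
  apply: eq_integral => w _; rewrite sumEFin big_enum; congr EFin.
  rewrite /degree_count -sum1_card natr_sum big_mkcond; apply: eq_bigr => x _.
  rewrite inE indicE; case: eqP => e; first by rewrite mem_set.
  by rewrite memNset.
rewrite ge0_integral_sum//; last first.
  by move=> x; apply/measurable_EFinP; exact: measurable_indic.
rewrite /mean_count -sumEFin big_enum; apply: eq_bigr => x _.
by rewrite integral_indic// setIT fineK// fin_num_measure.
Qed.

(** Summing over old vertices the law of a degree to which one Bernoulli variable
of parameter zeta/(t+1) is added; the last term is the newcomer. *)
Lemma mean_count_rec (k t : nat) : (1 <= t)%N -> zeta <= t.+1%:R ->
  mean_count k t.+1 = (1 - zeta / t.+1%:R) * mean_count k t
    + zeta / t.+1%:R * delay (mean_count ^~ t) k + pmass P (deg (@ord_max t.+1)) k.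
Proof.
move=> t1 zt; rewrite {1}/mean_count big_ord_recr /=; congr (_ + _).
have -> : delay (mean_count ^~ t) k = \sum_(x : 'I_t.+1) delay (pmass P (deg x)) k.
  by case: k => [|k] //=; rewrite big1.
rewrite /mean_count !mulr_sumr -big_split /=; apply: eq_bigr => x _.
rewrite deg_old// (pmass_add_event (rgp_indep hG) k _ (decoupled_degree x t1)).
- by rewrite (rgp_prob hG)// min_l//= addrC.
- by move=> p /=; apply: leq_trans; rewrite ltnS.
- exact: ltnSn.
Qed.

Lemma pmass_new_vertex (k t : nat) : (1 <= t)%N -> zeta <= t.+1%:R ->
  pmass P (deg (@ord_max t.+1)) k
    = 'C(t.+1, k)%:R * (zeta / t.+1%:R) ^+ k * (1 - zeta / t.+1%:R) ^+ (t.+1 - k).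
Proof.
move=> t1 zt; rewrite deg_new (pmass_count (rgp_indep hG) k (uniq_edges _) (edges_free _)
  (fun p => edges_prob _))//; by rewrite size_map size_enum_ord min_l.
Qed.

Lemma mean_count_ge0 (k t : nat) : 0 <= mean_count k t.
Proof. by apply: sumr_ge0 => x _; exact/fine_ge0/measure_ge0. Qed.

Lemma mean_count_le (k t : nat) : (1 <= t)%N -> mean_count k t <= t.+1%:R.
Proof.
move=> t1; rewrite -[leRHS]mulr1 mulr_natl -[X in 1 *+ X](card_ord t.+1) -sumr_const.
apply: ler_sum => x _; rewrite -lee_fin fineK ?fin_num_measure//.
  by apply: probability_le1; exact: (decoupled_degree x t1).1.
exact: (decoupled_degree x t1).1.
Qed.

End DegreeProcess.

(** * Geometric bounds *)

Theorem corollary1p4 (R : realType) (zeta : R) (hzeta : 0 < zeta)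
    (d : measure_display) (T : measurableType d) (P : probability T R)
    (G : graph_process T) (hG : random_graph_process P zeta G) :
  exists C1 C2 : R, [/\ 0 < C1, 0 < C2 &
    forall k : nat,
      [/\ ((C1 * (zeta / (1 + zeta)) ^+ k)%:E
             <= limn_einf (fun t : nat =>
                  mean_degree_count P G k t / (t%:R)%:E))%E,
          (limn_einf (fun t : nat => mean_degree_count P G k t / (t%:R)%:E)
             <= limn_esup (fun t : nat =>
                  mean_degree_count P G k t / (t%:R)%:E))%E &
          (limn_esup (fun t : nat => mean_degree_count P G k t / (t%:R)%:E)
             <= (C2 * (zeta / (1 + zeta)) ^+ k)%:E)%E]].
Proof.
set rho := zeta / (1 + zeta).
have z1 : 0 < 1 + zeta by rewrite addr_gt0.
have rhoz : (1 + zeta) * rho = zeta by rewrite mulrC divfK// gt_eqF.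
have rho0 : 0 < rho by rewrite divr_gt0.
pose M := mean_count P G.
(* From T0 > 2 zeta on, the edge probability is zeta/t and is at most 1/2. *)
pose T0 := (Num.truncn (zeta *+ 2)).+1.
have z2T t : (T0 <= t)%N -> zeta *+ 2 <= t%:R.
  by move=> h; rewrite ltW// (lt_le_trans (truncnS_gt _))// ler_nat.
have zT t : (T0 <= t)%N -> zeta <= t%:R.
  by move=> /z2T; apply: le_trans; rewrite mulr2n lerDr ltW.
pose b k t := if t is s.+1 then pmass P (fun w => degree (G s.+1 w) ord_max) k else 0.
have recM k t : (T0 <= t)%N -> M k t.+1 = (1 - zeta / t.+1%:R) * M k t
     + zeta / t.+1%:R * delay (M ^~ t) k + b k t.+1.
  by move=> h; apply: (mean_count_rec hG); [exact: (@leq_trans T0)|exact/zT/leqW].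
have bE k t : (T0 < t)%N ->
    b k t = 'C(t, k)%:R * (zeta / t%:R) ^+ k * (1 - zeta / t%:R) ^+ (t - k).
  by case: t => [//|t] h; apply: (pmass_new_vertex hG);
    [exact: (@leq_trans T0)|exact/zT/ltnW].
pose beta0 : R := expR (- (zeta *+ 2)).
pose C1 := beta0 / (1 + zeta).
pose C2 := expR (1 + zeta) / (1 + zeta).
have C1_0 : 0 < C1 by rewrite divr_gt0// expR_gt0.
have C2_0 : 0 < C2 by rewrite divr_gt0// expR_gt0.
exists C1, C2; split=> // k; split.
(* B is chosen so that u_k (T0+1) - B <= 0 for every k at once. *)
- pose u k := C1 * rho ^+ k.
  apply: (@limn_einf_ratio_ge _ _ _ (u k - C1 * T0.+1%:R) T0) => t T0t.
  rewrite (mean_degree_countE hG); last exact: (@leq_trans T0).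
  rewrite lee_fin addrA -[X in _ + X - _]mulr1 -mulrDr -mulrSr.
  apply: (@recursion_ge _ zeta _ T0 M b u (fun k => beta0 * (k == 0)%:R)) => //.
  + exact: zT.
  + by rewrite mulr_ge0 ?ltW.
  + move=> {T0t}j {}t T0t; rewrite bE//; case: j => [|j] /=.
      rewrite mulr1 bin0 !mul1r subn0 expR_le_binomial0//; exact/z2T/ltnW.
    have q1 : zeta / t%:R <= 1.
      rewrite ler_pdivrMr; first by rewrite mul1r; exact/zT/ltnW.
      by rewrite ltr0n (leq_ltn_trans _ T0t).
    by rewrite mulr0 !mulr_ge0 ?exprn_ge0 ?divr_ge0 ?subr_ge0// ltW.
  + case=> [|j] /=; rewrite /u.
      by rewrite expr0 mulr0 add0r !mulr1 /C1 mulrC divfK// gt_eqF.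
    by rewrite mulr0 addr0 exprS -[zeta in RHS]rhoz; ring.
  + move=> j; apply: le_trans (mean_count_ge0 _ _ _ _); rewrite subr_le0.
    rewrite ler_wpM2r// /u; apply: ler_piMr; first exact: ltW.
    apply: exprn_ile1; first exact: ltW.
    by rewrite ler_pdivrMr// mul1r lerDr.
- exact: limn_einf_sup.
(* B = T0+1 is the number of vertices at time T0, which bounds m_k(T0). *)
- pose u k := rho ^+ k / (1 + zeta) * series (exp_coeff (1 + zeta)) k.+1.
  have u0 j : 0 <= u j.
    apply: mulr_ge0; first by rewrite divr_ge0 ?exprn_ge0 ?ltW.
    by apply: sumr_ge0 => i _; rewrite exp_coeff_ge0// ltW.
  apply: (@le_trans _ _ (u k)%:E); last first.
    rewrite lee_fin [leRHS](_ : _ = rho ^+ k / (1 + zeta) * expR (1 + zeta)).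
      apply: ler_wpM2l; first by rewrite divr_ge0 ?exprn_ge0// ltW.
      by apply: sum_exp_coeff_le; exact: ltW.
    by rewrite /C2; ring.
  apply: (@limn_esup_ratio_le _ _ _ (u k + T0.+1%:R) T0) => t T0t.
  rewrite (mean_degree_countE hG)//; last exact: (@leq_trans T0).
  rewrite lee_fin addrA -[X in _ + X + _]mulr1 -mulrDr -mulrSr.
  apply: (@recursion_le _ zeta _ T0 M b u (exp_coeff zeta)) => //.
  + exact: zT.
  + by move=> j {T0t}t T0t; rewrite bE// binomial_le_poisson// ltW//= zT// ltnW.
  + move=> j.
    have e i : (1 + zeta) * u i = rho ^+ i * series (exp_coeff (1 + zeta)) i.+1.
      by rewrite /u mulrA [_ * (_ / _)]mulrC divfK// gt_eqF.
    (* zeta = rho (1+zeta): the forcing zeta^j/j! is rho^j times the next term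
       of the exponential series at 1+zeta. *)
    have zX i : exp_coeff zeta i = rho ^+ i * exp_coeff (1 + zeta) i.
      by rewrite !exp_coeffE -[X in _ * X ^+ _]rhoz exprMn; ring.
    rewrite e seriesSr mulrDr -zX; case: j => [|j] /=.
      by rewrite /series /= big_geq// mulr0 mulr0.
    by rewrite -[X in X * u j + _]rhoz mulrAC e exprS; ring.
  + move=> j; apply: (@le_trans _ _ T0.+1%:R); first exact: (mean_count_le hG).
    by rewrite lerDr mulr_ge0.
Qed.
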